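(* For each integer $N\ge2$ there exists a Lipschitz map $f:[0,1]\to\mathbb{R}^N$ with $f(0)=\mathbf{0}$ such that $\mathrm{Tan}(f([0,1]),\mathbf{0})=\mathfrak{C}_U(\mathbb{R}^N;\mathbf{0})$.
   Context: $\mathfrak{C}_U(\mathbb{R}^N;\mathbf{0})$ denotes the collection of all closed sets $X\subset\mathbb{R}^N$ with $\mathbf{0}\in X$ such that every connected component of $X$ is unbounded. With $\mathrm{exc}(A,B)=\sup_{a\in A}\inf_{b\in B}|a-b|$, closed sets $X_m\to X$ (Attouch–Wets) iff for every $r>0$, $\mathrm{exc}(X_m\cap\overline{B}(\mathbf{0},r),X)\to0$ and $\mathrm{exc}(X\cap\overline{B}(\mathbf{0},r),X_m)\to0$; a closed $T\ni\mathbf{0}$ belongs to $\mathrm{Tan}(X,x)$ if $r_j^{-1}(X-x)\to T$ for some $r_j\downarrow0$. *)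

(* Defs.v *)
From HB Require Import structures.
From mathcomp Require Import all_boot all_order all_algebra.
From mathcomp Require Import all_classical all_reals all_analysis.
Set Implicit Arguments. Unset Strict Implicit. Unset Printing Implicit Defensive.
Import Order.TTheory GRing.Theory Num.Theory.
Import numFieldNormedType.Exports.
Local Open Scope classical_set_scope.
Local Open Scope ring_scope.

Section Defs.
Variables (R : realType) (N : nat).
Local Notation V := 'rV[R]_N.

Definition edist (a b : V) : R := Num.sqrt (\sum_(i < N) (a ord0 i - b ord0 i) ^+ 2).

Definition cball0 (r : R) : set V := [set y | edist 0 y <= r].

(* exc(A,B) = sup_{a in A} inf_{b in B} |a - b|, in extended reals,
   with the convention exc(emptyset, B) = 0 (the terms are >= 0, so adding 0
   to the set does not change the supremum otherwise). *)
Definition exc (A B : set V) : \bar R :=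
  ereal_sup (0%E |` [set ereal_inf [set (edist a b)%:E | b in B] | a in A]).

Definition AW_cvg (Xm : nat -> set V) (X : set V) : Prop :=
  forall r : R, 0 < r ->
    (fun m => exc (Xm m `&` cball0 r) X) @ \oo --> 0%E /\
    (fun m => exc (X `&` cball0 r) (Xm m)) @ \oo --> 0%E.

Definition blowup (X : set V) (x : V) (r : R) : set V :=
  [set r^-1 *: (y - x) | y in X].

Definition Tan (X : set V) (x : V) : set (set V) :=
  [set T : set V | closed T /\ T 0 /\
     exists r : nat -> R, (forall j, 0 < r j) /\ nonincreasing_seq r /\
       r @ \oo --> 0 /\ AW_cvg (fun j => blowup X x (r j)) T].

Definition unbounded (C : set V) : Prop := ~ exists M : R, forall y, C y -> edist 0 y <= M.

Definition CU : set (set V) :=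
  [set X : set V | closed X /\ X 0 /\ forall x, X x -> unbounded (connected_component X x)].

Definition lipschitz01 (f : R -> V) : Prop :=
  exists L : R, forall s t, s \in `[0, 1] -> t \in `[0, 1] ->
    edist (f s) (f t) <= L * `|s - t|.
End Defs.

(* Main.v *)
From Pilot Require Import Defs.
From HB Require Import structures.
From mathcomp Require Import all_boot all_order all_algebra.
From mathcomp Require Import all_classical all_reals all_analysis.
From mathcomp Require Import ring lra.
Import Order.TTheory GRing.Theory Num.Theory.
Import numFieldNormedType.Exports.
(* all_analysis exports another edist. *)
Import Pilot.Defs.
Set Implicit Arguments.
Unset Strict Implicit.
Local Open Scope classical_set_scope.
Local Open Scope ring_scope.

(** A tangent set T of a nondegenerate connected compact set is a limit of
    connected sets of diameter going to infinity.  Following chains of smaller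
    and smaller steps in these, each x in T is joined inside T to points of any
    prescribed norm by arbitrarily fine chains; in a compact set, being joined by
    arbitrarily fine chains to x defines a connected set, so the component of x
    in T is unbounded.

    Conversely, if all the components of X are unbounded, the part of X between
    the norms a and 4 m (a small, m large), together with a thin inner shell
    around the origin and an outer shell, is connected by chains of small steps
    (here N >= 2 matters: shells are connected); hence it is traced by a finite
    walk, which can be taken among countably many rational ones.  Enumerate these
    walks and perform them one after the other, at scales decreasing fast enough
    for the resulting infinite polygon to have finite length, and for every walk
    to be out of sight (very far or very close to 0) at the scales of the others.
    Parametrized by the remaining length, this is the Lipschitz curve wanted. *)

(** * Chains of short steps in a normed space *)

Section Chains.
Variables (R : realType) (V : normedModType R).
Implicit Types (S T K : set V) (x y z : V) (e : R).

Inductive chain e S x : V -> Prop :=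
| chain_refl : S x -> chain e S x x
| chain_step y z : chain e S x y -> S z -> `|y - z| <= e -> chain e S x z.

Lemma chain_end e S x y : chain e S x y -> S y.
Proof. by case. Qed.

Lemma chain_start e S x y : chain e S x y -> S x.
Proof. by elim. Qed.

Lemma chain_trans e S x y z : chain e S x y -> chain e S y z -> chain e S x z.
Proof.
move=> xy; elim=> // u v _ xu Sv uv.
exact: chain_step xu Sv uv.
Qed.

Lemma chain1 e S x y : S x -> S y -> `|x - y| <= e -> chain e S x y.
Proof. by move=> Sx; apply: chain_step; apply: chain_refl. Qed.

Lemma chain_sym e S x y : chain e S x y -> chain e S y x.
Proof.
elim=> [Sx|u v xu ux Sv uv]; first exact: chain_refl.
apply: chain_trans ux; apply: chain1 => //; first exact: chain_end xu.
by rewrite distrC.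
Qed.

Lemma chain_sub e e' S T x y : e <= e' -> S `<=` T ->
  chain e S x y -> chain e' T x y.
Proof.
move=> ee ST; elim=> [Sx|u v _ xu Sv uv]; first exact/chain_refl/ST.
by apply: chain_step xu (ST _ Sv) (le_trans uv ee).
Qed.

Lemma chain_first_exit e S P x y : chain e S x y -> P x ->
  chain e (S `&` P) x y \/
  exists u v, [/\ chain e (S `&` P) x u, S v, ~ P v & `|u - v| <= e].
Proof.
move=> c Px; elim: c => [Sx|u v _ [xu|ex] Sv uv]; first by left; apply: chain_refl.
- have [Pv|nPv] := pselect (P v); first by left; apply: chain_step xu _ uv.
  by right; exists u, v.
- by right.
Qed.

(** Discrete intermediate value principle: the last step is at most [e], so [v] overshoots [P] by at
    most [e], which locates its norm or distance in each application. *)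
Lemma chain_exit e S P x y : chain e S x y -> P x -> ~ P y ->
  exists u v, [/\ chain e (S `&` P) x u, S v, ~ P v & `|u - v| <= e].
Proof.
by move=> /chain_first_exit h /h [/chain_end[]|].
Qed.

(** The set of points reachable from [x] is relatively open and closed in [C]: it and its complement
    in [C] are both traces of unions of [e]-balls. *)
Lemma connected_chain e (C : set V) x y : 0 < e -> connected C -> C x -> C y ->
  chain e C x y.
Proof.
move=> e0 cC Cx Cy; set B := [set z | chain e C x z].
suff BC : B = C by move: Cy; rewrite -{1}BC.
apply: cC; first by exists x; apply: chain_refl.
- exists (\bigcup_(z in B) ball z e).
    by apply: bigcup_open => z _; apply: ball_open.
  apply/seteqP; split=> z; rewrite /B/=.
    by move=> cz; split; [exact: chain_end cz|exists z => //; exact: ballxx].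
  move=> [Cz [w cw]]; rewrite -ball_normE /= => /ltW wz.
  exact: chain_step cw Cz wz.
- exists (~` \bigcup_(z in C `\` B) ball z e).
    by apply: open_closedC; apply: bigcup_open => z _; apply: ball_open.
  apply/seteqP; split=> z; rewrite /B/=.
    move=> cz; split; first exact: chain_end cz.
    move=> [w [Cw ncw]]; rewrite -ball_normE /= => /ltW wz; apply: ncw.
    by apply: chain_step cz Cw _; rewrite distrC.
  move=> [Cz nz]; apply: contrapT => ncz; apply: nz.
  by exists z; [split|exact: ballxx].
Qed.

(** Each new step goes back to the old chain, along it, and over to [T] again, hence the factor
    3. *)
Lemma chain_transfer e S T x x' y : chain e S x y ->
    (forall s, S s -> exists2 t, T t & `|s - t| <= e) -> T x' -> `|x - x'| <= e ->
  exists2 y', chain (e *+ 3) T x' y' & `|y - y'| <= e.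
Proof.
move=> c ST Tx' xx'; elim: c => [_|u v _ [u' xu' uu'] Sv uv].
  by exists x' => //; apply: chain_refl.
have [v' Tv' vv'] := ST _ Sv; exists v' => //.
apply: chain_step xu' Tv' _.
rewrite (_ : u' - v' = (u' - u) + (u - v) + (v - v')).
  rewrite mulrS mulr2n addrA; apply: le_trans (ler_normD _ _) _; apply: lerD => //.
  by apply: le_trans (ler_normD _ _) _; apply: lerD => //; rewrite distrC.
by rewrite !addrA !subrK.
Qed.

(* Any cluster point of the ends of ever finer chains is one more short step
   away from some of them. *)
Lemma chain_cluster K (Z : set V) x : compact K -> closed Z ->
    (forall e, 0 < e -> exists2 v, Z v & chain e K x v) ->
  exists2 w, Z w & forall e, 0 < e -> chain e K x w.
Proof.
move=> cK cZ h.
have hn n : exists v, Z v /\ chain (n.+1%:R^-1) K x v.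
  by have [|v Zv cv] := h (n.+1%:R^-1); [rewrite invr_gt0 ltr0n|exists v].
pose v n := projT1 (cid (hn n)).
have Zv n : Z (v n) by rewrite /v; case: cid => ? [].
have cv n : chain (n.+1%:R^-1) K x (v n) by rewrite /v; case: cid => ? [].
have Kv n : K (v n) := chain_end (cv n).
have [|w [Kw clw]] := cK (v @ \oo) _; first by exists 0%N => // n _; exact: Kv.
have near_w e : 0 < e -> exists n, n.+1%:R^-1 <= e /\ `|v n - w| <= e.
  move=> e0; have := clw [set v n | n in [set n | n.+1%:R^-1 <= e]] (ball w e).
  case.
  - have := near_infty_natSinv_lt (PosNum e0).
    by apply: filterS => n /= ne; exists n => //=; exact: ltW.
  - exact: nbhsx_ballx.
  move=> z [[n /= ne <-]]; rewrite -ball_normE/= => /ltW; rewrite distrC => vw.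
  by exists n.
exists w.
  apply: cZ => B Bw; have [|z []] := clw Z B _ Bw; first by exists 0%N => // n _; exact: Zv.
  by exists z.
move=> e e0; have [n [ne vw]] := near_w e e0.
apply: (@chain_step _ _ _ (v n)) => //.
exact: chain_sub (cv n).
Qed.

End Chains.

(** * Arbitrarily fine chains and connectedness in compact sets *)

Section ChainComponents.
Variables (R : realType) (V : normedModType R).
Implicit Types (S T K A B : set V) (x y z : V) (e : R).

Lemma closed_far (c : R) A : closed [set y : V | forall a, A a -> c <= `|y - a|].
Proof.
rewrite (_ : mkset _ = \bigcap_(a in A) [set y | c <= `|y - a|]) //.
apply: closed_bigI => a _.
apply: (@preimage_closed _ _ (fun y : V => `|y - a|) [set r | c <= r]).
  by move=> y _; apply: cvg_norm; apply: cvgB; [exact: cvg_id|exact: cvg_cst].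
exact: closed_ge.
Qed.

(** A threshold valid at a point of [A] is halved to stay valid in a neighbourhood; compactness, as
    near-covering, then yields one for all of [A]. *)
Lemma compact_closed_dist A B : compact A -> closed B -> A `&` B = set0 ->
  exists2 d : R, 0 < d & forall a b, A a -> B b -> d <= `|a - b|.
Proof.
move=> cA cB AB.
have H : forall a, A a -> \forall a' \near a & e \near (0 : R)^'+,
    forall b, B b -> e <= `|a' - b|.
  move=> a Aa.
  have : (~` B) a by move=> Ba; have : (A `&` B) a by []; rewrite AB.
  move=> nB; have := open_nbhs_nbhs (conj (closed_openC cB) nB).
  move=> /nbhs_ballP[r /= r0 rB].
  exists (ball a (r / 2), [set e | e <= r / 2]) => /=.
    split; first by apply: nbhsx_ballx; lra.
    by apply: nbhs_right_le; lra.
  move=> [a' e] /= []; rewrite -ball_normE /= => aa' er b Bb.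
  rewrite leNgt; apply/negP => a'b; apply: (rB b) Bb.
  rewrite -ball_normE /=.
  rewrite (_ : a - b = (a - a') + (a' - b)); last by rewrite addrA subrK.
  apply: le_lt_trans (ler_normD _ _) _; lra.
have nc := (compact_near_coveringP A).1 cA _ _ _ _ H.
have : \forall e \near (0 : R)^'+, 0 < e /\ A `<=` (fun a => forall b, B b -> e <= `|a - b|).
  near=> e; split; first by near: e; exact: nbhs_right_gt.
  by near: e; exact: nc.
move=> /filter_ex[e [e0 He]]; exists e => // a b Aa; exact: He.
Unshelve. all: end_near. Qed.

Lemma chain_component_closed K x : compact K ->
  closed [set z | forall e, 0 < e -> chain e K x z].
Proof.
move=> cK z Qz e e0.
have [w [Qw]] := Qz (ball z e) (nbhsx_ballx _ _ e0).
rewrite -ball_normE/= => /ltW zw.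
apply: (chain_step (Qw e e0)); last by rewrite distrC.
have cK' : closed K by apply: compact_closed => //; exact: norm_hausdorff.
apply: cK' => W Wz.
have [v [Qv Wv]] := Qz W Wz; exists v; split => //.
exact: chain_end (Qv 1 ltr01).
Qed.

(** If the set split into two closed parts at distance [d], fine chains from one to the other would
    have a point in the gap between them; a cluster point of these points would belong to the set
    but to neither part. *)
Lemma chain_component_connected K x : compact K ->
  connected [set z | forall e, 0 < e -> chain e K x z].
Proof.
move=> cK; set Q := [set z | _].
have clQ : closed Q by exact: chain_component_closed.
have QK : Q `<=` K by move=> z /(_ 1 ltr01); exact: chain_end.
have cQ A : closed A -> A `<=` Q -> compact A.
  by move=> clA AQ; apply: subclosed_compact cK _ => // z /AQ/QK.
have sep A B : closed A -> closed B -> Q = A `|` B -> A `&` B = set0 -> A x ->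
    B = set0.
  move=> clA clB QAB AB0 Ax; apply: contrapT => /eqP/set0P[z Bz].
  have AQ : A `<=` Q by rewrite QAB; exact: subsetUl.
  have [d d0 dAB] := compact_closed_dist (cQ A clA AQ) clB AB0.
  pose h := d / 2.
  have h0 : 0 < h by rewrite divr_gt0.
  have hd : h + h = d by rewrite /h; lra.
  (* The gap. The first point of a chain at distance at least [h] from [A] is less than [h + h / 2]
     away from some point of [A], hence more than [h / 2] away from [B]. *)
  pose Z := [set y : V | forall a, A a -> h <= `|y - a|] `&`
            [set y : V | forall a, B a -> h / 2 <= `|y - a|].
  have cZ : closed Z by apply: closedI; exact: closed_far.
  have [|w [Zw1 Zw2] Qw] := @chain_cluster _ _ K Z x cK cZ.
    move=> e e0; pose e1 := Num.min e (h / 2).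
    have e10 : 0 < e1 by rewrite lt_min e0 divr_gt0.
    have e1e : e1 <= e by rewrite ge_min lexx.
    have e1h : e1 <= h / 2 by rewrite ge_min lexx orbT.
    have Qz : Q z by rewrite QAB; right.
    have [||u [v [cu Kv nv uv]]] :=
      @chain_exit _ _ e1 K [set y | exists2 a, A a & `|y - a| < h] x z (Qz _ e10).
    + by exists x => //; rewrite subrr normr0.
    + by move=> [a Aa]; rewrite distrC => ?; have := dAB a z Aa Bz; lra.
    have [a Aa ua] := (chain_end cu).2.
    exists v.
      split=> b Hb /=.
        by rewrite leNgt; apply/negP => vb; apply: nv; exists b.
      have := dAB a b Aa Hb.
      rewrite (_ : a - b = (a - u) + (u - v) + (v - b)); last by rewrite !addrA !subrK.
      move=> /le_trans /(_ (ler_normD _ _)).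
      move: (ler_normD (a - u) (u - v)); rewrite (distrC a u).
      lra.
    apply: (@chain_step _ _ _ _ _ u) => //; last exact: le_trans e1e.
    by apply: chain_sub cu => // ? [].
  have : Q w by [].
  rewrite QAB => -[/Zw1|/Zw2]; rewrite subrr normr0; lra.
move=> B B0 [C1 oC1 BC1] [C2 cC2 BC2].
have clB : closed B by rewrite BC2; exact: closedI.
pose B' := Q `&` ~` C1.
have clB' : closed B' by apply: closedI => //; exact: open_closedC.
have QBB' : Q = B `|` B' by rewrite BC1 /B' -setIUr setUv setIT.
have BB'0 : B `&` B' = set0 by rewrite BC1 /B' setIACA setICr setI0.
have [Qx|nQx] := pselect (Q x); last first.
  (* If [x] is not in [Q] then [Q] is empty: a chain from [x] forces [x] to lie in [K], and then the
     trivial chain puts [x] in [Q]. *)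
  have [b] := B0; rewrite BC1 => -[Qb _]; exfalso; apply: nQx => e e0.
  by apply: chain_refl; exact: chain_start (Qb e e0).
move: (Qx); rewrite {1}QBB' => -[Bx|B'x].
  by have B'0 := sep _ _ clB clB' QBB' BB'0 Bx; rewrite QBB' B'0 setU0.
by case: B0 => b; rewrite (sep B' B) // 1?setUC // setIC.
Qed.

End ChainComponents.

(** * Maximum norm, Euclidean distance and excess *)

Section Excess.
Variables (R : realType) (N : nat).
Local Notation V := 'rV[R]_N.
Implicit Types (A B T X : set V) (x y a b : V).

Lemma normr_coord x i : `|x ord0 i| <= `|x|.
Proof.
by rewrite [leRHS]/Num.Def.normr /= mx_normrE; apply/bigmax_geP; right => /=; exists (ord0, i).
Qed.

Lemma normr_row_le x c : 0 <= c -> (forall i, `|x ord0 i| <= c) -> `|x| <= c.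
Proof.
move=> c0 xc; rewrite [leLHS]/Num.Def.normr /= mx_normrE bigmax_le//= => -[i j] _ /=.
by rewrite (ord1 i).
Qed.

(** The norm of row vectors is the maximum norm; this bound and [normr_le_edist] allow all estimates
    to be made in it. *)
Lemma edist_le a b : edist a b <= N%:R * `|a - b|.
Proof.
rewrite /edist -(ger0_norm (_ : 0 <= N%:R * `|a - b|)) ?mulr_ge0// -sqrtr_sqr.
rewrite ler_wsqrtr //.
apply: (@le_trans _ _ (\sum_(i < N) `|a - b| ^+ 2)).
  apply: ler_sum => i _; rewrite -real_normK ?num_real// lerXn2r ?nnegrE//.
  by have := normr_coord (a - b) i; rewrite !mxE.
rewrite sumr_const card_ord -[leLHS]mulr_natl exprMn ler_wpM2r ?sqr_ge0//.
by rewrite -natrX ler_nat; case: (N) => // n; rewrite expnS leq_pmulr // expn_gt0.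
Qed.

Lemma normr_le_edist a b : `|a - b| <= edist a b.
Proof.
apply: normr_row_le => [|i]; first exact: sqrtr_ge0.
rewrite /edist -sqrtr_sqr ler_wsqrtr // (bigD1 i) //= !mxE lerDl.
by apply: sumr_ge0 => *; exact: sqr_ge0.
Qed.

Lemma exc_lt A B (e : R) a : (exc A B < e%:E)%E -> A a ->
  exists2 b, B b & edist a b < e.
Proof.
move=> AB Aa.
have : (ereal_inf [set (edist a b)%:E | b in B] < e%:E)%E.
  apply: le_lt_trans AB; apply: ereal_sup_ubound; right; by exists a.
by move=> /ereal_inf_lt[_ [b Bb <-]]; rewrite lte_fin; exists b.
Qed.

Lemma exc_ge0 A B : (0 <= exc A B)%E.
Proof. by apply: ereal_sup_ubound; left. Qed.

Lemma exc_le A B (e : R) : 0 <= e ->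
  (forall a, A a -> exists2 b, B b & edist a b <= e) -> (exc A B <= e%:E)%E.
Proof.
move=> e0 AB; apply: ge_ereal_sup => _ [->|[a /AB[b Bb ab] <-]].
  by rewrite lee_fin.
by apply: ge_ereal_inf; exists (edist a b)%:E; rewrite ?lee_fin //; exists b.
Qed.

Lemma exc_cvg_near (A B : nat -> set V) (e : R) : 0 < e ->
  (fun m => exc (A m) (B m)) @ \oo --> 0%E ->
  \forall m \near \oo, (exc (A m) (B m) < e%:E)%E.
Proof.
move=> e0 /(_ [set y | (y < e%:E)%E]); apply.
by apply: open_nbhs_nbhs; split; [exact: open_ereal_lt_ereal|rewrite /= lte_fin].
Qed.

Lemma exc_cvg0 (A B : nat -> set V) (u : nat -> R) : u @ \oo --> 0 ->
    (\forall m \near \oo, (exc (A m) (B m) <= (u m)%:E)%E) ->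
  (fun m => exc (A m) (B m)) @ \oo --> 0%E.
Proof.
move=> u0 ABu; apply: (@squeeze_cvge _ _ _ _ (cst 0%E) _ (fun m => (u m)%:E)).
- by apply: filterS ABu => m ->; rewrite exc_ge0.
- exact: cvg_cst.
- by apply: cvg_EFin => //; near=> m.
Unshelve. all: end_near. Qed.

End Excess.

(** * Tangent sets of a connected set *)

Section TangentSets.
Variables (R : realType) (N : nat).
Local Notation V := 'rV[R]_N.
Implicit Types (A B T X : set V) (x y a b : V).

Lemma Tan_sub_CU X : connected X -> X 0 -> (exists2 p, X p & p != 0) ->
  Tan X 0 `<=` @CU R N.
Proof.
move=> cX X0 [p Xp p0] T [clT [T0 [r [r_gt0 [_ [r_cvg AW]]]]]].
split=> //; split=> // x Tx [M HM].
(* Chains from [x] inside [T] will reach norm [m - 1], which exceeds the supposed bound [M] on the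
   component of [x]. *)
pose m := `|M| + `|x| + 3.
have mM : M + 3 <= m.
  by rewrite /m; have := ler_norm M; have := normr_ge0 x; lra.
have mx : `|x| + 3 <= m by rewrite /m; have := normr_ge0 M; lra.
have x0 := normr_ge0 x.
have clB (c : R) : closed [set z : V | `|z| <= c].
  apply: (@preimage_closed _ _ (fun y : V => `|y|) [set s | s <= c]).
    by move=> y _; exact: norm_continuous.
  exact: closed_le.
pose K := T `&` [set z | `|z| <= m + 1].
have cK : compact K.
  apply: bounded_closed_compact; last exact: closedI.
  exists (m + 1); split; first exact: num_real.
  by move=> c mc z [_ /= /le_trans]; apply; exact: ltW.
pose Z := [set y : V | forall a, [set 0] a -> m - 1 <= `|y - a|].
have [|w Zw cw] := @chain_cluster _ _ K Z x cK (@closed_far _ _ _ _).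
  (* [e / 3] pays for the factor 3 of [chain_transfer]; [1 / 3] keeps the transferred points below
     norm [m + 1] and their end above [m - 1]. *)
  move=> e e0; pose h := Num.min (e / 3) (1 / 3).
  have h0 : 0 < h by rewrite lt_min; apply/andP; split; lra.
  have he : h <= e / 3 by rewrite ge_min lexx.
  have h1 : h <= 1 / 3 by rewrite ge_min lexx orbT.
  pose c := N%:R * (m + 1) + 1.
  have c0 : 0 < c by rewrite ltr_wpDl // mulr_ge0 //; lra.
  have in_cball y : `|y| <= m + 1 -> cball0 c y.
    move=> ym; rewrite /cball0 /=; apply: (le_trans (edist_le _ _)).
    rewrite sub0r normrN /c; apply: (@le_trans _ _ (N%:R * (m + 1))).
      by rewrite ler_wpM2l.
    by rewrite lerDl.
  have [AW1 AW2] := AW c c0.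
  (* The last condition sends the blown-up [p] beyond norm [m + 1], so that chains in the blow-up
     can leave the ball of radius [m]. *)
  have [j [e1 e2 rj]] : exists j, [/\
      (exc (blowup X 0 (r j) `&` cball0 c) T < h%:E)%E,
      (exc (T `&` cball0 c) (blowup X 0 (r j)) < h%:E)%E &
      r j * (m + 1) < `|p|].
    suff /filter_ex[j ?] : \forall j \near \oo, [/\
      (exc (blowup X 0 (r j) `&` cball0 c) T < h%:E)%E,
      (exc (T `&` cball0 c) (blowup X 0 (r j)) < h%:E)%E &
      r j * (m + 1) < `|p|] by exists j.
    near=> j; split.
    - by near: j; exact: (@exc_cvg_near _ _ _ (fun=> T)).
    - by near: j; exact: (@exc_cvg_near _ _ (fun=> T `&` _)).
    - rewrite -ltr_pdivlMr; last lra.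
      near: j; apply: (cvgr_lt 0) => //.
      by rewrite divr_gt0 ?normr_gt0//; lra.
  set Xj := blowup X 0 (r j) in e1 e2.
  have cXj : connected Xj.
    apply: connected_continuous_connected => //; apply: continuous_subspaceT.
    rewrite (_ : (fun y : V => _) = *:%R (r j)^-1); first exact: scaler_continuous.
    by apply/funext => y; rewrite subr0.
  have [xj Xxj /ltW xxj] : exists2 y, Xj y & edist x y < h.
    apply: (exc_lt e2); split => //; apply: in_cball; lra.
  have {}xxj := le_trans (normr_le_edist _ _) xxj.
  have Xq : Xj ((r j)^-1 *: (p - 0)) by exists p.
  have qm : m + 1 < `|(r j)^-1 *: (p - 0)|.
    by rewrite normrZ gtr0_norm ?invr_gt0// subr0 ltr_pdivlMl.
  have := connected_chain h0 cXj Xxj Xq.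
  have lexj : `|xj| <= m.
    rewrite (_ : xj = x - (x - xj)); last by rewrite subKr.
    apply: le_trans (ler_normB _ _) _; lra.
  move=> /(@chain_exit _ _ _ _ [set y | `|y| <= m]) /(_ lexj) [|].
    by move=> /=; lra.
  move=> u [v [cu _ /= /negP]]; rewrite -ltNge => vm uv.
  have XK s : (Xj `&` [set y | `|y| <= m]) s -> exists2 t, K t & `|s - t| <= h.
    move=> [Xs /= sm].
    have [|t Tt st] := exc_lt (a := s) e1.
      by split => //; apply: in_cball; lra.
    have {}st := le_trans (normr_le_edist _ _) (ltW st).
    exists t => //; split => //=.
    rewrite (_ : t = s - (s - t)); last by rewrite subKr.
    apply: le_trans (ler_normB _ _) _; lra.
  have Kx : K x by split => //=; lra.
  have [|y' cy' uy'] := chain_transfer cu XK Kx; first by rewrite distrC.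
  exists y'; last first.
    apply: chain_sub cy' => //; rewrite -mulr_natl; lra.
  move=> _ ->; rewrite subr0.
  have := ler_normB u (u - v); rewrite subKr.
  have := ler_normD y' (u - y'); rewrite addrCA subrr addr0.
  lra.
have Tw : connected_component T x w.
  apply: (connected_component_max _ _ (chain_component_connected (x := x) cK)) => //=.
  - by move=> e e0; apply: chain_refl; split => //=; lra.
  - by move=> z /(_ 1 ltr01) /chain_end[].
have := le_trans (normr_le_edist _ _) (HM w Tw).
by have := Zw 0 erefl; rewrite sub0r normrN subr0; lra.
Unshelve. all: end_near. Qed.

End TangentSets.

(** * Lipschitz curves through a prescribed sequence of points *)

Section Curves.
Variables (R : realType) (N : nat).
Local Notation V := 'rV[R]_N.

(** Each coordinate is extended by the infimum of [p i ord0 c + |x - t i|] over [i]; in the maximum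
    norm the constant 1 survives. *)
Lemma mcshane_extension (I : Type) (i0 : I) (t : I -> R) (p : I -> V) :
    (forall i j, `|p i - p j| <= `|t i - t j|) ->
  exists2 f : R -> V, (forall x y, `|f x - f y| <= `|x - y|) &
    forall i, f (t i) = p i.
Proof.
move=> ptij.
have pc c i j : p i ord0 c - p j ord0 c <= `|t i - t j|.
  apply: le_trans (ler_norm _) _; apply: le_trans (ptij i j).
  by have := normr_coord (p i - p j) c; rewrite !mxE.
pose E c x := [set p i ord0 c + `|x - t i| | i in [set: I]].
have lbE c x : lbound (E c x) (p i0 ord0 c - `|t i0 - x|).
  move=> _ [i _ <-]; have := pc c i0 i.
  by have := ler_distD x (t i0) (t i); lra.
have hlb c x : has_lbound (E c x) by exists (p i0 ord0 c - `|t i0 - x|).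
have E0 c x : E c x !=set0 by exists (p i0 ord0 c + `|x - t i0|); exists i0.
have infD c x y : inf (E c x) - inf (E c y) <= `|x - y|.
  rewrite lerBlDr -lerBlDl; apply: lb_le_inf => // _ [i _ <-].
  rewrite lerBlDl; apply: (@le_trans _ _ (p i ord0 c + `|x - t i|)).
    by apply: ge_inf => //; exists i.
  by have := ler_distD y x (t i); lra.
exists (fun x => \row_c inf (E c x)).
  move=> x y; apply: normr_row_le => // c; rewrite !mxE ler_norml infD andbT.
  by rewrite lerNl opprB distrC infD.
move=> i; apply/rowP => c; rewrite !mxE; apply/eqP; rewrite eq_le; apply/andP; split.
  apply: ge_inf => //; exists i => //.
  by rewrite subrr normr0 addr0.
apply: lb_le_inf => // _ [j _ <-]; have := pc c i j; lra.
Qed.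

(* The curve visits p i at time S - (d 0 + .. + d i.-1), S being the sum of d. *)
Lemma rectifiable_curve (p : nat -> V) (d : nat -> R) (B : R) :
    (forall i, `|p i - p i.+1| <= d i) ->
    (forall n, \sum_(i < n) d i <= B) ->
    (forall e m, 0 < e -> exists2 i, (m <= i)%N & `|p i| < e) ->
  exists L f, [/\ forall x y, `|f x - f y| <= L * `|x - y|,
    f 0 = 0,
    forall i, exists2 t, t \in `[0, 1] & f t = p i &
    forall t, t \in `[0, 1] -> f t = 0 \/ exists i, `|f t - p i| <= d i].
Proof.
move=> pd dB p0; pose s n := \sum_(i < n) d i.
have sS i : s i.+1 = s i + d i by rewrite /s big_ord_recr.
have d0 i : 0 <= d i := le_trans (normr_ge0 _) (pd i).
have ps i k : `|p i - p (i + k)%N| <= s (i + k)%N - s i.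
  elim: k => [|k IH]; first by rewrite addn0 !subrr normr0.
  rewrite addnS sS; have := ler_distD (p (i + k)%N) (p i) (p (i + k).+1).
  by have := pd (i + k)%N; lra.
have smono i j : (i <= j)%N -> s i <= s j.
  move=> ij; have := ps i (j - i)%N; rewrite subnKC //.
  by have := normr_ge0 (p i - p j); lra.
pose S := sup (range s).
have ubs : has_ubound (range s) by exists B => _ [n _ <-]; exact: dB.
have hs : has_sup (range s) by split => //; exists (s 0%N); exists 0%N.
have sle i : s i <= S by apply: ub_le_sup => //; exists i.
pose t i := S - s i.
have t_ge0 i : 0 <= t i by rewrite subr_ge0.
have t_le i : t i <= S by rewrite /t lerBlDr lerDl /s sumr_ge0.
have S0 : 0 <= S := le_trans (t_ge0 0%N) (t_le 0%N).
have t_small e : 0 < e -> exists n, t n < e.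
  by move=> e0; have [_ [n _ <-] sn] := sup_adherent e0 hs; exists n; move: sn; rewrite -/S /t; lra.
have [|f fL ft] := @mcshane_extension nat 0%N t p.
  move=> i j; wlog ij : i j / (i <= j)%N.
    by move=> h; have [/h//|/ltnW/h] := leqP i j; rewrite distrC (distrC (t i)).
  move: ij (ps i (j - i)%N) => /subnKC -> /le_trans; apply.
  by have := ler_norm (t i - t j); rewrite /t; lra.
(* The times [t i] tend to 0, and arbitrarily late points [p i] are arbitrarily small. *)
have f00 : f 0 = 0.
  apply/eqP; rewrite -normr_eq0; apply/negPn/negP => f0.
  have {}f0 : 0 < `|f 0| / 2 by rewrite divr_gt0// lt_def f0 /=.
  have [n tn] := t_small _ f0.
  have [i ni pi] := p0 _ n f0.
  have ti : t i <= t n by rewrite /t lerD2l lerN2 smono.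
  have := ler_normD (f 0 - f (t i)) (f (t i)); rewrite subrK.
  have := fL 0 (t i); rewrite sub0r normrN (ger0_norm (t_ge0 i)) ft; lra.
exists S, (fun x => f (S * x)); split.
- by move=> x y; apply: le_trans (fL _ _) _; rewrite -mulrBr normrM ger0_norm.
- by rewrite mulr0.
- move=> i; exists (t i / S).
    rewrite in_itv /= divr_ge0 //=.
    (* For [S = 0] the quotient [t i / S] is 0 by convention; all [t i] vanish, so all [p i] equal
       [f 0]. *)
    have [->|S_neq0] := eqVneq S 0; first by rewrite invr0 mulr0.
    by rewrite ler_pdivrMr ?mul1r ?t_le// lt_def S_neq0.
  have [S_eq0|S_neq0] := eqVneq S 0; last by rewrite mulrC divfK // ft.
  rewrite S_eq0 mul0r; have -> : 0 = t i; last by rewrite ft.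
  by apply/eqP; rewrite eq_le t_ge0 -S_eq0 t_le.
- move=> u; rewrite in_itv /= => /andP[u0 u1].
  have Su : S * u <= S by rewrite ler_piMr.
  have [Su0|Su0] := leP (S * u) 0.
    left; have -> // : S * u = 0.
    by apply/eqP; rewrite eq_le Su0 mulr_ge0.
  right; have ex := t_small _ Su0.
  (* Minimality puts [S * u] between [t i.+1] and [t i], an interval of length [d i]. *)
  case: (ex_minnP ex) => -[|i] ti min.
    by move: ti; rewrite /t /s big_ord0 subr0 => ?; lra.
  exists i; rewrite -ft; apply: le_trans (fL _ _) _.
  have tSu : S * u <= t i by rewrite leNgt; apply/negP => /min; rewrite ltnn.
  rewrite ler0_norm; last lra.
  by move: ti; rewrite /t sS; lra.
Qed.

End Curves.

(** * Finite walks, their rounding, and finite nets *)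

Section Walks.
Variables (R : realType) (V : normedModType R).
Implicit Types (S K : set V) (x y z : V) (e : R).

Definition step e : rel V := fun x y => `|x - y| <= e.

Lemma segment_chain e S x y : 0 < e ->
  (forall t, 0 <= t <= 1 -> S (x + t *: (y - x))) -> chain e S x y.
Proof.
move=> e0 Sxy; pose g (t : R) := x + t *: (y - x).
have cg : connected (g @` `[0, 1]).
  apply: connected_continuous_connected; first exact: segment_connected.
  apply: continuous_subspaceT => t.
  by apply: cvgD; [exact: cvg_cst|apply: cvgZr_tmp; exact: cvg_id].
apply: (@chain_sub _ _ e e (g @` `[0, 1])) => //.
  by move=> _ [t + <-]; rewrite /= in_itv /=; exact: Sxy.
apply: connected_chain => //.
  by exists 0; [rewrite /= in_itv /= lexx ler01|rewrite /g scale0r addr0].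
by exists 1; [rewrite /= in_itv /= lexx ler01|rewrite /g scale1r addrC subrK].
Qed.

Lemma chain_path e S x y : chain e S x y ->
  exists s, [/\ path (step e) x s, last x s = y & forall z, z \in s -> S z].
Proof.
elim=> [Sx|u v _ [s [ps su Ss]] Sv uv]; first by exists [::].
exists (rcons s v); rewrite rcons_path ps last_rcons su; split=> // z.
by rewrite mem_rcons inE => /orP[/eqP->|/Ss].
Qed.

(** Each point of [F] is visited by an excursion from [x] and back, put in front of a walk from [x]
    to [y]. *)
Lemma chain_walk e S x y (F : seq V) :
    (forall z, S z -> chain e S z x) -> S y -> (forall z, z \in F -> S z) ->
  exists s, [/\ path (step e) x s, last x s = y, forall z, z \in s -> S z &
    forall z, z \in F -> z \in x :: s].
Proof.
move=> cS Sy; elim: F => [|z F IH] SF.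
  by have [s [ps sy Ss]] := chain_path (chain_sym (cS y Sy)); exists s.
have [|s [ps sy Ss Fs]] := IH; first by move=> w wF; apply: SF; rewrite inE wF orbT.
have cz := cS z (SF z (mem_head z F)).
have [s1 [ps1 s1z Ss1]] := chain_path (chain_sym cz).
have [s2 [ps2 s2x Ss2]] := chain_path cz.
exists (s1 ++ s2 ++ s); rewrite !cat_path !last_cat s1z s2x ps1 ps2; split=> //.
  by move=> w; rewrite !mem_cat => /or3P[/Ss1|/Ss2|/Ss].
have zs : z \in x :: s1 by rewrite -s1z mem_last.
move=> w; rewrite inE => /orP[/eqP->|/Fs].
  by move: zs; rewrite !inE mem_cat => /orP[->//|->]; rewrite orbT.
by rewrite !inE !mem_cat => /orP[->//|->]; rewrite !orbT.
Qed.

Lemma path_perturb e d (rd : V -> V) x x' s :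
    (forall z, `|z - rd z| <= d) -> `|x - x'| <= d -> path (step e) x s ->
  path (step (e + d *+ 2)) x' (map rd s) /\
  `|last x s - last x' (map rd s)| <= d.
Proof.
move=> rdd; elim: s x x' => [|z s IH] x x' xx' //= /andP[xz ps].
have [-> ?] := IH z (rd z) (rdd z) ps; split => //; rewrite andbT /step.
have := ler_distD x x' (rd z); have := ler_distD z x (rd z).
by rewrite (distrC x' x) mulr2n; have := rdd z; rewrite /step in xz; lra.
Qed.

Lemma compact_net K e : compact K -> 0 < e -> exists F : seq V,
  (forall z, z \in F -> K z) /\ forall x, K x -> exists2 z, z \in F & `|x - z| <= e.
Proof.
rewrite compact_cover => cK e0.
have [||F FK Fcov] := cK _ K (fun z => ball z e).
- by move=> z _; exact: ball_open.
- by move=> z Kz; exists z => //; exact: ballxx.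
exists (finmap.enum_fset F); split; first by move=> z zF; have := FK z zF; rewrite inE.
move=> x /Fcov[z zF]; rewrite -ball_normE /= distrC => /ltW; by exists z.
Qed.

End Walks.

(** * Finite patterns approximating a set with unbounded components *)

Section Patterns.
Variables (R : realType) (N : nat).
Local Notation V := 'rV[R]_N.
Implicit Types (X : set V) (x y z : V) (a b e : R).

Definition shell a b : set V := [set y | a <= `|y| <= b].

(** All patterns start and end on this line, so that successive ones can be joined along it. *)
Definition diag a : V := const_mx a.

Lemma normr_diag a : (0 < N)%N -> 0 <= a -> `|diag a| = a.
Proof.
move=> N0 a0; apply/eqP; rewrite eq_le; apply/andP; split.
  by apply: normr_row_le => // i; rewrite mxE ger0_norm.
by have := normr_coord (diag a) (Ordinal N0); rewrite mxE ger0_norm.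
Qed.

Lemma normr_row_max x : (0 < N)%N -> exists i, `|x| = `|x ord0 i|.
Proof.
move=> N0; have [x0|x0] := eqVneq `|x| 0.
  exists (Ordinal N0); apply/eqP; rewrite eq_le normr_coord andbT x0.
  exact: normr_ge0.
have [[i j] /= xj] := mx_norm_neq0 x0.
by exists j; rewrite [LHS]xj (ord1 i).
Qed.

(** The common coordinate keeps the maximum norm above [a] along the segment; convexity keeps it
    below [b]. *)
Lemma shell_segment_chain e a b x y i : 0 < e -> x ord0 i = y ord0 i ->
  a <= `|x ord0 i| -> `|x| <= b -> `|y| <= b -> chain e (shell a b) x y.
Proof.
move=> e0 xyi axi xb yb; apply: segment_chain => // t /andP[t0 t1].
apply/andP; split.
  apply: le_trans (normr_coord _ i).
  by rewrite !mxE -xyi subrr mulr0 addr0.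
rewrite (_ : _ + _ = (1 - t) *: x + t *: y); last first.
  by rewrite scalerBr scalerBl scale1r addrA addrAC.
apply: le_trans (ler_normD _ _) _; rewrite !normrZ !ger0_norm; [|lra..].
nra.
Qed.

(* First push all the coordinates but one of maximal modulus to b, then,
   another coordinate holding the norm at b, push the remaining one. *)
Lemma shell_chain e a b y : (2 <= N)%N -> 0 < e -> 0 <= b -> shell a b y ->
  chain e (shell a b) y (diag b).
Proof.
move=> N2 e0 b0 /andP[ay yb].
have [i yi] := normr_row_max y (ltnW N2).
have ab := le_trans ay yb.
pose j : 'I_N := if i == Ordinal N2 then Ordinal (ltnW N2) else Ordinal N2.
have ji : j != i.
  rewrite /j; have [->|ni] := eqVneq i (Ordinal N2); first by rewrite -val_eqE.
  by rewrite eq_sym.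
pose w : V := \row_k if k == i then y ord0 i else b.
have wb : `|w| <= b.
  apply: normr_row_le => // k; rewrite mxE; case: ifP => _; last by rewrite ger0_norm.
  exact: le_trans (normr_coord _ _) yb.
apply: (@chain_trans _ _ _ _ _ w).
  apply: (@shell_segment_chain _ _ _ _ _ i) => //; last by rewrite -yi.
  by rewrite mxE eqxx.
apply: (@shell_segment_chain _ _ _ _ _ j) => //.
- by rewrite !mxE (negbTE ji).
- by rewrite mxE (negbTE ji) ger0_norm.
- by rewrite normr_diag // ltnW.
Qed.

Lemma CU_far X c x : CU X -> X x -> exists2 y, connected_component X x y & c < `|y|.
Proof.
move=> [_ [_ XU]] Xx; apply: contrapT => h; apply: (XU x Xx).
exists (N%:R * c) => y Cy; apply: (le_trans (edist_le _ _)).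
rewrite sub0r normrN ler_wpM2l // leNgt; apply/negP => cy; apply: h.
by exists y.
Qed.

(* The outer shell joins the components of X, the inner one removes the origin. *)
Definition region X a m : set V :=
  [set y | shell a (4 * m) y /\ [\/ X y, `|y| <= 2 * a | m + 1 <= `|y|]].

(** The component of a point of [X], followed until it leaves the norms from [2 * a] to [m + 1],
    leads to one of the two shells. Each shell is chained, and the component of the origin joins
    them. *)
Lemma region_chain X a m e : (2 <= N)%N -> CU X -> 0 < e <= a -> a <= 1 -> 1 <= m ->
  forall y, region X a m y -> chain e (region X a m) y (diag (4 * m)).
Proof.
move=> N2 cuX /andP[e0 ea] a1 m1; set S := region X a m.
have X0 : X 0 := cuX.2.1.
have out y : shell (m + 1) (4 * m) y -> chain e S y (diag (4 * m)).
  move=> ym; have m0 : 0 <= 4 * m by lra.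
  apply: chain_sub (shell_chain N2 e0 m0 ym) => //.
  by move=> z /andP[z1 z2]; split; [apply/andP; split; lra|constructor 3].
have inn y z : shell a (2 * a) y -> shell a (2 * a) z -> chain e S y z.
  move=> ya za; apply: (@chain_sub _ _ e _ (shell a (2 * a))) => //.
    by move=> u /andP[u1 u2]; split; [apply/andP; split; lra|constructor 2].
  have c u : shell a (2 * a) u -> chain e (shell a (2 * a)) u (diag (2 * a)).
    by apply: shell_chain => //; lra.
  exact: chain_trans (c y ya) (chain_sym (c z za)).
have comp_chain x y : connected_component X x y -> X x -> chain e X x y.
  move=> xy Xx; have xx := connected_component_refl Xx.
  apply: chain_sub (connected_chain e0 (@component_connected _ X x) xx xy) => //.
  exact: connected_component_sub.
(* From the origin a chain in [X] is followed to its first point beyond [m + 1], then read backwards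
   until it drops below [2 * a]. Steps of at most [a] cannot jump over the inner shell. *)
have [w [wa cw]] : exists w, shell a (2 * a) w /\ chain e S w (diag (4 * m)).
  have [y X0y ym] := CU_far (m + 1) cuX X0.
  have [||u [v [cu Xv nv uv]]] :=
    @chain_exit _ _ e X [set z | `|z| <= m + 1] 0 y (comp_chain _ _ X0y X0).
  - by rewrite /= normr0; lra.
  - by rewrite /=; lra.
  have um := (chain_end cu).2; rewrite /= in um.
  have vm : m + 1 < `|v| by move: nv => /= /negP; rewrite -ltNge.
  have v4 : `|v| <= 4 * m by have := ler_distD u v 0; rewrite !subr0 distrC; lra.
  have cv : chain e (X `&` [set z | `|z| <= 4 * m]) v 0.
    apply: chain_sym; apply: (@chain_step _ _ _ _ _ u) => //.
    by apply: chain_sub cu => // z [Xz /= zm]; split => //=; lra.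
  have [||u1 [v1 [cu1 Xv1 nv1 uv1]]] :=
    @chain_exit _ _ e _ [set z | 2 * a <= `|z|] _ _ cv.
  - by rewrite /=; lra.
  - by rewrite /= normr0; lra.
  have ua1 := (chain_end cu1).2; rewrite /= in ua1.
  have va1 : `|v1| < 2 * a by move: nv1 => /= /negP; rewrite -ltNge.
  have v1a : a <= `|v1| by have := ler_distD v1 u1 0; rewrite !subr0; lra.
  exists v1; split; first by apply/andP; split => //; lra.
  apply: (@chain_trans _ _ _ _ _ v); last by apply: out; apply/andP; split; lra.
  apply: chain_sym; apply: (@chain_step _ _ _ _ _ u1) => //.
    apply: chain_sub cu1 => // z [[Xz /= z4] z2].
    by split; [apply/andP; split => //; lra|constructor 1].
  by split; [apply/andP; split => //; lra|constructor 2; lra].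
move=> y [/andP[ay y4] cy].
have [ya|ya] := leP `|y| (2 * a).
  apply: chain_trans cw; apply: inn => //; exact/andP.
have [my|my] := leP (m + 1) `|y|; first by apply: out; apply/andP.
have Xy : X y by case: cy => //; lra.
have [z yz zm] := CU_far (m + 1) cuX Xy.
have [||u [v [cu Xv nv uv]]] :=
  @chain_exit _ _ e X (shell (2 * a) (m + 1)) y z (comp_chain _ _ yz Xy).
- by apply/andP; split; lra.
- by move=> /andP[_]; lra.
have /andP[ua um] := (chain_end cu).2.
have vu := ler_distD u v 0; have uv' := ler_distD v u 0.
rewrite !subr0 in vu uv'; rewrite (distrC v u) in vu.
have v_shell : shell a (4 * m) v by apply/andP; split; lra.
have /andP[v1 v2] := v_shell.
have v_case : `|v| <= 2 * a \/ m + 1 <= `|v|.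
  have [|va] := leP `|v| (2 * a); first by left.
  have [|vm] := leP (m + 1) `|v|; first by right.
  by case: nv; apply/andP; split; lra.
have Sv : S v by split => //; case: v_case => ?; [constructor 2|constructor 3].
apply: (@chain_trans _ _ _ _ _ v).
  apply: (@chain_step _ _ _ _ _ u) => //.
  apply: chain_sub cu => // x [Xx /andP[x1 x2]].
  by split; [apply/andP; split; lra|constructor 1].
case: v_case => ?; last by apply: out; apply/andP.
by apply: chain_trans cw; apply: inn => //; apply/andP.
Qed.

Definition vrat (q : 'rV[rat]_N) : V := map_mx ratr q.

Lemma vrat_dense e y : 0 < e -> exists q, `|y - vrat q| <= e.
Proof.
move=> e0.
have h i : exists q : rat, `|y ord0 i - ratr q| <= e.
  have [|q] := @rat_in_itvoo R (y ord0 i - e) (y ord0 i + e); first lra.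
  by rewrite in_itv /= => /andP[q1 q2]; exists q; rewrite ler_norml; lra.
exists (\row_i projT1 (cid (h i))).
by apply: normr_row_le => [|i]; [exact: ltW|rewrite !mxE; case: cid].
Qed.

(* Pattern of precision 1 / n.+1, as a walk from the outside to near the origin.
   Rational intermediate points make the patterns countable. *)
Definition core (n : nat) (L : seq 'rV[rat]_N) : seq V :=
  diag (4 * n.+1%:R) :: rcons (map vrat L) (diag n.+1%:R^-1).

(** These bounds are looser by a factor 2 than those of an [a / 8]-walk in [region X a m], with
    [m = n.+1] and [a = 1 / m]: this leaves room for rounding. *)
Definition valid (n : nat) (L : seq 'rV[rat]_N) :=
  sorted (step (n.+1%:R^-1 / 4)) (core n L) /\
  forall z, z \in core n L -> shell (n.+1%:R^-1 / 2) (8 * n.+1%:R) z.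

(** The two excesses within radius [n.+1]. Points of [X] very close to the origin are exempt: the
    point 0 of the curve will stand for them. *)
Definition approximates X (n : nat) (L : seq 'rV[rat]_N) :=
  (forall z, z \in core n L -> `|z| <= n.+1%:R ->
     exists2 x, X x & `|z - x| <= 4 * n.+1%:R^-1) /\
  (forall x, X x -> `|x| <= n.+1%:R -> `|x| <= n.+1%:R^-1 \/
     exists2 z : V, z \in core n L & `|z - x| <= 2 * n.+1%:R^-1).

(** An [a]-net of the part of [X] between norms [a] and [m] is visited by a walk in the region,
    whose points are then rounded to rational ones. *)
Lemma valid_approximation X n : (2 <= N)%N -> CU X ->
  exists2 L, valid n L & approximates X n L.
Proof.
move=> N2 cuX; set m : R := n.+1%:R; set a := m^-1.
have m1 : 1 <= m by rewrite ler1n.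
have a0 : 0 < a by rewrite invr_gt0; lra.
have a1 : a <= 1 by rewrite invf_le1 //; lra.
have N0 := ltnW N2.
pose S := region X a m.
have Sch := @region_chain X a m (a / 8) N2 cuX (_ : 0 < a / 8 <= a) a1 m1.
have {}Sch : forall y, S y -> chain (a / 8) S y (diag (4 * m)).
  by apply: Sch; apply/andP; split; lra.
have SA : S (diag a).
  by split; [apply/andP|constructor 2]; rewrite normr_diag ?(ltW a0)//; [split|]; lra.
have clX : closed X := cuX.1.
have cK : compact (X `&` shell a m).
  apply: bounded_closed_compact.
    exists m; split; first exact: num_real.
    by move=> c mc z [_ /andP[_ /le_trans]]; apply; exact: ltW.
  apply: closedI => //.
  rewrite (_ : shell a m = (fun y => `|y|) @^-1` `[a, m]); last first.
    by apply/seteqP; split=> z; rewrite /shell /= in_itv.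
  apply: preimage_closed; last exact: itv_closed.
  by move=> y _; exact: norm_continuous.
have [F [FK Fnet]] := compact_net cK a0.
have [|s [ps sA Ss Fs]] := @chain_walk _ _ (a / 8) S (diag (4 * m)) (diag a) F Sch SA.
  move=> z /FK[Xz /andP[za zm]].
  by split; [apply/andP; split => //; lra|constructor 1].
have hrd z : exists q, `|z - vrat q| <= a / 16 by apply: vrat_dense; lra.
pose qd z := projT1 (cid (hrd z)).
have rdd z : `|z - vrat (qd z)| <= a / 16 by rewrite /qd; case: cid.
pose rd z := vrat (qd z).
have rd_norm z : `|z| - a / 16 <= `|rd z| <= `|z| + a / 16.
  have := rdd z; have := ler_distD (rd z) z 0; have := ler_distD z (rd z) 0.
  by rewrite !subr0 (distrC (rd z) z) -/(rd z) => *; apply/andP; split; lra.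
have rdE : map vrat (map qd s) = map rd s by rewrite -map_comp.
have coreP z : z \in core n (map qd s) ->
    [\/ z = diag (4 * m), z = diag a | exists2 y, S y & z = rd y].
  rewrite /core -/m -/a rdE inE mem_rcons inE => /or3P[/eqP|/eqP|/mapP[y ys]] ->.
  - by constructor 1.
  - by constructor 2.
  - by constructor 3; exists y => //; exact: Ss.
have nB : `|diag (4 * m)| = 4 * m by rewrite normr_diag //; lra.
have nA : `|diag a| = a by rewrite normr_diag //; lra.
exists (map qd s); split.
- rewrite /core -/m -/a rdE /= rcons_path.
  have [|p1 p2] := path_perturb rdd (_ : `|diag (4 * m) - diag (4 * m)| <= a / 16) ps.
    by rewrite subrr normr0; lra.
  rewrite sA in p2.
  (* Step length [a / 8] plus a rounding error [a / 16] at both ends. *)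
  rewrite (_ : a / 4 = a / 8 + (a / 16) *+ 2); last by rewrite mulr2n; lra.
  by rewrite p1 /= /step distrC (le_trans p2) // mulr2n; lra.
- move=> z /coreP[->|->|[y [/andP[y1 y2] _] ->]]; rewrite /shell /= -/m -/a.
  + by rewrite nB; apply/andP; split; lra.
  + by rewrite nA; apply/andP; split; lra.
  + by have /andP[] := rd_norm y => *; apply/andP; split; lra.
- have X0 : X 0 := cuX.2.1.
  move=> z /coreP[->|->|[y [/andP[y1 y2] yc] ->]]; rewrite -/m -/a.
  + by rewrite nB; lra.
  + by rewrite nA => _; exists 0; rewrite // subr0 nA; lra.
  + have /andP[r1 r2] := rd_norm y; move=> rm.
    (* Outer shell points still have norm above [m] after rounding; inner shell points are matched
       with 0. *)
    case: yc => [Xy|ya|]; last lra.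
      by exists y => //; have := rdd y; rewrite distrC -/(rd y); lra.
    by exists 0 => //; rewrite subr0; lra.
- move=> x Xx; rewrite -/m -/a => xm.
  have [|ax] := leP `|x| a; first by left.
  right; have [|y yF xy] := Fnet x; first by split => //; apply/andP; split => //; exact: ltW.
  have := Fs y yF; rewrite inE => /orP[/eqP yB|ys].
    by exists y; rewrite ?yB ?/core ?mem_head // -yB distrC; lra.
  exists (rd y); first by rewrite /core rdE inE mem_rcons inE map_f ?orbT.
  have := rdd y; have := ler_distD y (rd y) x.
  by rewrite (distrC (rd y) y) (distrC y x) -/(rd y); lra.
Qed.

End Patterns.

(** * Concatenation of infinitely many walks *)

Lemma concat_stream (T : eqType) (hd : nat -> T) (tl : nat -> seq T) (e : rel T) :
    (forall k, path e (hd k) (rcons (tl k) (hd k.+1))) ->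
  exists p : nat -> T, [/\ forall i, e (p i) (p i.+1),
    forall i, exists k, p i \in hd k :: tl k,
    forall k u, u \in hd k :: tl k -> exists i, p i = u,
    forall k, exists2 i, (k <= i)%N & p i \in hd k :: tl k &
    forall (R : realType) (g : T -> R) n,
      (forall k u, u \in hd k :: tl k -> 0 <= g u) ->
      \sum_(i < n) g (p i) <= \sum_(k < n) \sum_(u <- hd k :: tl k) g u].
Proof.
move=> ek; pose b k := hd k :: tl k; pose W k := flatten (mkseq b k).
(* No block is empty, so the first [i.+1] blocks already contain entry [i]. *)
pose x0 := hd 0%N; pose p i := nth x0 (W i.+1) i.
have WS k : W k.+1 = W k ++ b k.
  by rewrite /W /mkseq -addn1 iotaD map_cat flatten_cat /= cats0 add0n.
have Wadd k j : exists s, W (k + j)%N = W k ++ s.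
  elim: j => [|j [s IH]]; first by exists [::]; rewrite addn0 cats0.
  by exists (s ++ b (k + j)%N); rewrite addnS WS IH catA.
have sW k : (k <= size (W k))%N.
  elim: k => // k IH; rewrite WS size_cat /= addnS ltnS.
  by rewrite (leq_trans IH) // leq_addr.
have Wnth k i : (i < size (W k))%N -> nth x0 (W k) i = p i.
  move=> ik; rewrite /p; have [ki|ki] := leqP k i.+1.
    by have [s] := Wadd k (i.+1 - k)%N; rewrite subnKC // => ->; rewrite nth_cat ik.
  have [s] := Wadd i.+1 (k - i.+1)%N; rewrite subnKC 1?ltnW // => ->.
  by rewrite nth_cat sW.
have Wsort k : sorted e (rcons (W k) (hd k)).
  elim: k => // k IH; rewrite WS rcons_cat /= -cat_rcons.
  move: IH; case: (W k) => [|x s] /=; first by rewrite ek.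
  by rewrite cat_path last_rcons ek andbT.
have memW k u : u \in W k -> exists j, u \in b j.
  elim: k => [//|k IH]; rewrite WS mem_cat => /orP[/IH//|ub]; by exists k.
exists p; split.
- move=> i; have := Wsort i.+2; rewrite -cats1 => /cat_sorted2[/(sortedP x0) h _].
  by have := h i (sW i.+2); rewrite !Wnth // ltnW.
- by move=> i; apply: (memW i.+1); rewrite mem_nth.
- move=> k u ub; have uW : u \in W k.+1 by rewrite WS mem_cat ub orbT.
  by exists (index u (W k.+1)); rewrite -(Wnth k.+1) ?index_mem// nth_index.
- move=> k; exists (size (W k)); first exact: sW.
  by rewrite -(Wnth k.+1) WS ?size_cat /= ?nth_cat ?ltnn ?subnn ?mem_head // addnS ltnS leq_addr.
- move=> R g n g0.
  have -> : \sum_(k < n) \sum_(u <- hd k :: tl k) g u = \sum_(u <- W n) g u.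
    rewrite /W big_flatten big_map.
    by rewrite -(big_mkord predT (fun k => \sum_(u <- b k) g u)) /index_iota subn0.
  have -> : \sum_(i < n) g (p i) = \sum_(u <- take n (W n)) g u.
    rewrite (big_nth x0) size_takel // big_mkord; apply: eq_bigr => i _.
    by rewrite nth_take // Wnth // (leq_trans _ (sW n)).
  rewrite -{2}(cat_take_drop n (W n)) big_cat /= lerDl.
  rewrite big_seq sumr_ge0 // => u /mem_drop /memW[j]; exact: g0.
Qed.

(* At scale s the curve shows the pattern (n, L), up to what lies very close to
   the origin or very far from it. *)
Definition traces (R : realType) (N : nat) (f : R -> 'rV[R]_N) (s : R)
    (n : nat) (L : seq 'rV[rat]_N) : Prop :=
  (forall z, z \in core R n L -> exists2 t, t \in `[0, 1] & f t = s *: z) /\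
  (forall t, t \in `[0, 1] ->
    [\/ f t = 0,
        exists2 z : 'rV[R]_N, z \in core R n L &
          `|f t - s *: z| <= s * (n.+1%:R^-1 / 4),
        `|f t| <= 2 * (s * n.+1%:R^-1) | 4 * (s * n.+1%:R) <= `|f t| ]).

(** * All patterns performed on one curve, at decreasing scales *)

Section UniversalCurve.
Variables (R : realType) (N : nat).
Hypothesis N_gt0 : (0 < N)%N.
Local Notation V := 'rV[R]_N.
Variables (n : nat -> nat) (L : nat -> seq 'rV[rat]_N).
Hypothesis nL_valid : forall k, valid R (n k) (L k).

Let m k : R := (n k).+1%:R.
Let a k : R := (m k)^-1.
Let q k : seq V := core R (n k) (L k).
Let c k : R := (size (q k)).+1%:R.

(* Dividing by m k puts block k below block k.-1; dividing by c k makes the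
   lengths of the blocks summable. *)
Fixpoint scale k : R :=
  if k is k'.+1 then scale k' * a k' / (32 * m k * c k) else (c 0)^-1.
Local Notation r := scale.

Let m_ge1 k : 1 <= m k. Proof. by rewrite ler1n. Qed.
Let c_ge1 k : 1 <= c k. Proof. by rewrite ler1n. Qed.
Let a_gt0 k : 0 < a k. Proof. by rewrite invr_gt0; have := m_ge1 k; lra. Qed.
Let a_le1 k : a k <= 1.
Proof. by have := m_ge1 k; rewrite invf_le1 //; lra. Qed.

Lemma scale_gt0 k : 0 < r k.
Proof.
elim: k => [|k IH] /=; first by rewrite invr_gt0 ltr0n.
by rewrite !(divr_gt0, mulr_gt0) // ltr0n.
Qed.

Let scaleS k : 32 * (r k.+1 * m k.+1) * c k.+1 = r k * a k.
Proof.
rewrite /=; move: (m_ge1 k.+1) (c_ge1 k.+1) => m1 c1.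
by field; apply/andP; split; lra.
Qed.

Arguments scale : simpl never.

Let scale_drop k : 32 * (r k.+1 * m k.+1) <= r k * a k.
Proof.
have r0 := ltW (scale_gt0 k.+1); have m0 := le_trans ler01 (m_ge1 k.+1).
by rewrite -scaleS ler_peMr // mulr_ge0 // mulr_ge0.
Qed.

Let scale_a k : r k * a k <= r k.
Proof. by rewrite ler_piMr // ltW ?scale_gt0. Qed.

Let scale_m k : r k <= r k * m k.
Proof. by rewrite ler_peMr // ltW ?scale_gt0. Qed.

Let scale_m_mono i j : (i <= j)%N -> r j * m j <= r i * m i.
Proof.
move=> /subnKC <-; elim: (j - i)%N => [|k IH]; first by rewrite addn0.
rewrite addnS; apply: le_trans IH.
have := scale_drop (i + k); have := scale_a (i + k); have := scale_m (i + k).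
have := mulr_ge0 (ltW (scale_gt0 (i + k).+1)) (le_trans ler01 (m_ge1 (i + k).+1)).
lra.
Qed.

Lemma scale_decr k : r k.+1 <= r k.
Proof.
have := scale_drop k; have := scale_a k; have := scale_m k.+1.
by have := scale_gt0 k.+1; lra.
Qed.

Let scale_size k : r k * c k <= 2^-1 ^+ k.
Proof.
elim: k => [|k IH]; first by rewrite -[r 0]/((c 0)^-1) expr0 mulVf // pnatr_eq0.
rewrite exprS.
have : r k <= r k * c k by rewrite ler_peMr // ltW ?scale_gt0.
have : r k.+1 * c k.+1 <= r k.+1 * m k.+1 * c k.+1 by rewrite ler_wpM2r.
have := mulr_gt0 (scale_gt0 k.+1) (lt_le_trans ltr01 (c_ge1 k.+1)).
have := scaleS k; have := scale_a k; have := scale_gt0 k; lra.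
Qed.

Lemma scale_le k : r k <= 2^-1 ^+ k.
Proof.
by apply: le_trans (scale_size k); rewrite ler_peMr // ltW ?scale_gt0.
Qed.

(* Block k is the scaled core, followed by one long step along the diagonal to
   the head of block k.+1; each point comes with a bound on the next step. *)
Let scaled (k : nat) (z : V) : R * V := (r k * (a k / 4), r k *: z).
Let jump k : R := r k * a k - 4 * (r k.+1 * m k.+1).
Let hd k := scaled k (diag N (4 * m k)).
Let tl k :=
  rcons (map (scaled k) (behead (q k))) (jump k, diag N (r k * a k)).
Let near_step : rel (R * V) := fun u v => `|u.2 - v.2| <= u.1.

Let jump_ge0 k : 0 <= jump k.
Proof.
have := scale_drop k; rewrite /jump.
have := mulr_ge0 (ltW (scale_gt0 k.+1)) (le_trans ler01 (m_ge1 k.+1)).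
lra.
Qed.

Let blkE k : hd k :: tl k = rcons (map (scaled k) (q k)) (jump k, diag N (r k * a k)).
Proof. by []. Qed.

Let scaler_diag (x y : R) : x *: diag N y = diag N (x * y).
Proof. by apply/rowP => i; rewrite !mxE. Qed.

Let blk_path k : path near_step (hd k) (rcons (tl k) (hd k.+1)).
Proof.
have [qs _] := nL_valid k.
rewrite !rcons_path last_rcons -andbA; apply/and3P; split.
- have -> : hd k = scaled k (diag N (4 * m k)) by [].
  rewrite path_map; move: qs; rewrite /core /= -/(q k).
  apply: sub_path => x y; rewrite /step /near_step /= -scalerBr normrZ.
  by rewrite gtr0_norm ?scale_gt0// ler_pM2l ?scale_gt0.
- rewrite /near_step (last_map (scaled k) _ (diag N (4 * m k))) /q /core /=.
  rewrite last_rcons scaler_diag subrr normr0.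
  by rewrite !mulr_ge0 // ?invr_ge0 // ltW ?scale_gt0.
- rewrite /near_step /= scaler_diag.
  have -> : diag N (r k * a k) - diag N (r k.+1 * (4 * m k.+1)) = diag N (jump k).
    by apply/rowP => i; rewrite !mxE /jump; lra.
  by rewrite normr_diag.
Qed.

(** The [size (q k)] core points and the jump contribute at most [r k] each, which totals
    [r k * c k]. *)
Let blk_mass k : \sum_(u <- hd k :: tl k) u.1 <= 2^-1 ^+ k.
Proof.
apply: le_trans (scale_size k).
rewrite blkE -cats1 big_cat big_map /= big_seq1 /=.
rewrite big_const_seq count_predT iter_addr_0 -[X in X + _]mulr_natr.
rewrite /c -[(size _).+1%:R]natr1 mulrDr mulr1; apply: lerD.
  rewrite ler_wpM2r // ler_piMr ?ltW ?scale_gt0//.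
  by have := a_le1 k; lra.
have := mulr_ge0 (ltW (scale_gt0 k.+1)) (le_trans ler01 (m_ge1 k.+1)).
by have := scale_a k; rewrite /jump; lra.
Qed.

Let blk_cases k u (y : V) : u \in hd k :: tl k -> `|y - u.2| <= u.1 ->
  (exists2 z : V, z \in q k & `|y - r k *: z| <= r k * (a k / 4)) \/
  `|y| <= 2 * (r k * a k).
Proof.
rewrite blkE mem_rcons inE => /orP[/eqP->|/mapP[z zq ->]] /= yu; last by left; exists z.
right; have := ler_distD (diag N (r k * a k)) y 0; rewrite !subr0.
have ra0 : 0 <= r k * a k by rewrite mulr_ge0 ?ltW ?scale_gt0.
rewrite normr_diag //; move: yu; rewrite /jump.
have := mulr_ge0 (ltW (scale_gt0 k.+1)) (le_trans ler01 (m_ge1 k.+1)).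
lra.
Qed.

(** This confines the arc of block [k], jump included, to an annulus, and so makes it invisible at
    the scales of the other blocks. *)
Let blk_norm k u (y : V) : u \in hd k :: tl k -> `|y - u.2| <= u.1 ->
  4 * (r k.+1 * m k.+1) <= `|y| <= 9 * (r k * m k).
Proof.
have ra0 : 0 < r k * a k by rewrite mulr_gt0 ?scale_gt0.
have := scale_drop k; have := scale_a k; have := scale_m k => rm ra drop.
have h0 := mulr_ge0 (ltW (scale_gt0 k.+1)) (le_trans ler01 (m_ge1 k.+1)).
rewrite blkE mem_rcons inE => /orP[/eqP->|/mapP[z zq ->]] /= yu.
  have := ler_distD (diag N (r k * a k)) y 0.
  have := ler_distD y (diag N (r k * a k)) 0.
  rewrite !subr0 (distrC (diag _ _) y) normr_diag ?(ltW ra0) //.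
  by move: yu; rewrite /jump => *; apply/andP; split; lra.
have /andP[z1 z2] := (nL_valid k).2 z zq.
have nz : `|r k *: z| = r k * `|z| by rewrite normrZ gtr0_norm // scale_gt0.
have l1 : r k * (a k / 2) <= r k * `|z| by rewrite ler_pM2l ?scale_gt0.
have l2 : r k * `|z| <= r k * (8 * m k) by rewrite ler_pM2l ?scale_gt0.
rewrite !mulrA (mulrC (r k) 8) -!mulrA in l2; rewrite mulrA in l1 yu.
have := ler_distD (r k *: z) y 0; have := ler_distD y (r k *: z) 0.
rewrite !subr0 (distrC (_ *: z) y) nz => *; apply/andP; split; lra.
Qed.

Lemma universal_curve : exists l f, [/\
  forall x y : R, `|f x - f y| <= l * `|x - y|, f 0 = 0 :> V &
  forall k, traces f (r k) (n k) (L k)].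
Proof.
have [p [pS p_blk blk_p p_inf p_sum]] := concat_stream blk_path.
have p1_ge0 k u : u \in hd k :: tl k -> 0 <= u.1.
  rewrite blkE mem_rcons inE => /orP[/eqP->|/mapP[z _ ->]] /=; first exact: jump_ge0.
  by rewrite !mulr_ge0 ?invr_ge0 // ltW ?scale_gt0.
have [|||l [f [fl f0 fp fnear]]] :=
  @rectifiable_curve R N (fun i => (p i).2) (fun i => (p i).1) 2.
- exact: pS.
- move=> i; apply: le_trans (p_sum R fst i p1_ge0) _.
  apply: (@le_trans _ _ (\sum_(k < i) 2^-1 ^+ k)).
    by apply: ler_sum => k _; exact: blk_mass.
  have -> : \sum_(k < i) 2^-1 ^+ k = 2 - 2 * 2^-1 ^+ i :> R.
    elim: i => [|i IH]; first by rewrite big_ord0 expr0; lra.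
    by rewrite big_ord_recr /= IH exprS; lra.
  by have : 0 <= 2^-1 ^+ i :> R by []; lra.
- move=> e i e0.
  have [j je] : exists j, 2^-1 ^+ j < e / 9.
    have /cvgrPdist_lt /(_ (e / 9)) : (fun j => 2^-1 ^+ j : R) @ \oo --> 0.
      by apply: cvg_expr; rewrite ger0_norm; lra.
    move=> /(_ (divr_gt0 e0 (ltr0n _ 9))) /filter_ex[j].
    by rewrite sub0r normrN ger0_norm // => ?; exists j.
  (* Points of blocks after [j] have norm at most [9 * (r j.+1 * m j.+1)], which is below [9 * r j]
     and hence below [e]. *)
  have [k] := p_inf (maxn i j.+1); rewrite geq_max => /andP[ik jk] pk.
  exists k => //; have := blk_norm (y := (p k).2) pk.
  rewrite subrr normr0 => /(_ (p1_ge0 _ _ pk)) /andP[_].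
  have := scale_m_mono (leq_maxr i j.+1).
  have := scale_drop j; have := scale_a j; have := scale_le j.
  have := scale_gt0 j; lra.
exists l, f; split => // k; split => [z zq|t t01].
  have [|i pi] := blk_p k (scaled k z).
    by rewrite blkE mem_rcons inE map_f ?orbT.
  by have [t t01 ft] := fp i; exists t => //; rewrite ft pi.
have [->|[i fti]] := fnear t t01; first by constructor 1.
have [j pj] := p_blk i.
have /andP[b1 b2] := blk_norm pj fti.
(* Seen at scale [r k], earlier blocks are far away, later ones are close to the origin, and block
   [k] shows its core and a jump close to the origin. *)
have [jk|kj|jk] := ltngtP j k.
- by constructor 4; have := scale_m_mono jk; rewrite -/(m k); lra.
- constructor 3; have := scale_m_mono kj; have := scale_drop k.
  have : 0 < r k * a k by rewrite mulr_gt0 ?scale_gt0.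
  by rewrite -/(m k) -/(a k); lra.
- rewrite jk in pj; have [[z zq fz]|fa] := blk_cases pj fti.
    by constructor 2; exists z.
  by constructor 3.
Qed.

End UniversalCurve.

(** * Enumeration of the patterns and realization of every set of [CU] *)

Section Universality.
Variables (R : realType) (N : nat).
Local Notation V := 'rV[R]_N.

(** Used only to produce some valid walk, the default value in the enumeration of codes. *)
Lemma setT_CU : (0 < N)%N -> @CU R N setT.
Proof.
move=> N0; split; first exact: closedT; split=> // x _ [M HM].
pose g (t : R) : V := x + t *: diag N 1.
have cg : connected (range g).
  apply: connected_continuous_connected.
    by apply/connected_intervalP => s t _ _ u _.
  apply: continuous_subspaceT => t.
  by apply: cvgD; [exact: cvg_cst|apply: cvgZr_tmp; exact: cvg_id].
pose t := `|M| + `|x| + 1.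
have t0 : 0 <= t by rewrite /t; have := normr_ge0 M; have := normr_ge0 x; lra.
have gt : connected_component setT x (g t).
  apply: (connected_component_max _ _ cg) => //.
  by exists 0 => //; rewrite /g scale0r addr0.
have := le_trans (normr_le_edist _ _) (HM _ gt); rewrite sub0r normrN.
have := ler_normB (g t) x; rewrite {1}/g addrC addKr normrZ normr_diag //.
rewrite ger0_norm // mulr1 {1}/t; have := ler_norm M; lra.
Qed.

Lemma lipschitz_continuous (f : R -> V) (l : R) :
  (forall x y, `|f x - f y| <= l * `|x - y|) -> continuous f.
Proof.
move=> fl x; apply/cvgrPdist_lt => e e0.
have l0 : 0 < `|l| + 1 by have := normr_ge0 l; lra.
have : \forall y \near x, `|x - y| < e / (`|l| + 1).
  by apply: nbhsx_ballx; rewrite divr_gt0.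
apply: filterS => y; rewrite ltr_pdivlMr // => xy.
apply: le_lt_trans (fl x y) _; apply: le_lt_trans xy.
rewrite mulrC ler_wpM2l //; have := ler_norm l; lra.
Qed.

(* Pigeonhole on the m + 1 indices n = m, .., 2 m. *)
Lemma unbounded_codes (T : countType) (g : nat -> T) m :
  injective g -> exists2 n, (m <= n)%N & (m <= pickle (g n))%N.
Proof.
move=> gI; apply: contrapT => h.
have lt_m (i : 'I_m.+1) : (pickle (g (m + i)) < m)%N.
  rewrite ltnNge; apply/negP => mi; apply: h.
  by exists (m + i)%N; rewrite ?leq_addr.
pose F i := Ordinal (lt_m i).
have FI : injective F.
  move=> i j /(congr1 val) /= /(pcan_inj pickleK) /gI /addnI ij.
  exact/val_inj.
by have := leq_card F FI; rewrite !card_ord ltnn.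
Qed.

Lemma universal_codes : (2 <= N)%N -> exists n L,
  (forall k, @valid R N (n k) (L k)) /\
  forall X, @CU R N X -> forall m, exists k,
    [/\ (m <= k)%N, (m <= n k)%N & approximates X (n k) (L k)].
Proof.
move=> N2; have [L0 vL0 _] := valid_approximation 0 N2 (setT_CU (ltnW N2)).
pose T : countType := (nat * seq 'rV[rat]_N)%type.
(* Integers coding no valid pattern are sent to the default [(0, L0)], so every block of the curve
   is valid. *)
pose code k : nat * seq 'rV[rat]_N :=
  if unpickle k is Some u then if `[< valid R (u : T).1 u.2 >] then u else (0%N, L0)
  else (0%N, L0).
exists (fst \o code), (snd \o code); split.
  move=> k /=; rewrite /code; case: unpickle => // u.
  by case: ifPn => // /asboolP.
move=> X cuX m.
have hL n : exists L, valid R n L /\ approximates X n L.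
  by have [L ? ?] := valid_approximation n N2 cuX; exists L.
pose L n := projT1 (cid (hL n)).
have LP n : valid R n (L n) /\ approximates X n (L n) by rewrite /L; case: cid.
(* Distinct precisions give distinct codes, so a precision and its code can both be made large. *)
have gI : injective (fun n => (n, L n) : T) by move=> i j [].
have [n mn mk] := unbounded_codes m gI.
exists (pickle ((n, L n) : T)).
have codeE : code (pickle ((n, L n) : T)) = (n, L n).
  by rewrite /code pickleK /= asboolT //; case: (LP n).
by rewrite /comp codeE; split => //; case: (LP n).
Qed.

Lemma CU_sub_Tan (f : R -> V) (n : nat -> nat) (L : nat -> seq 'rV[rat]_N)
    (r : nat -> R) X :
    f 0 = 0 -> (forall k, 0 < r k) -> (forall k, r k.+1 <= r k) ->
    r @ \oo --> 0 -> (forall k, traces f (r k) (n k) (L k)) -> @CU R N X ->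
    (forall m, exists k,
      [/\ (m <= k)%N, (m <= n k)%N & approximates X (n k) (L k)]) ->
  Tan (f @` [set t | t \in `[0, 1]]) 0 X.
Proof.
move=> f0 r0 rS r_cvg ftr cuX Xk; set X0 := f @` _.
(* A subsequence of blocks approximating [X] ever better; monotonicity of [K] makes the scales
   nonincreasing. *)
have [K [Kj Kn Kapprox Kle]] : exists K : nat -> nat, [/\ forall j, (j < K j)%N,
    forall j, (j <= n (K j))%N, forall j, approximates X (n (K j)) (L (K j)) &
    forall j, (K j <= K j.+1)%N].
  have Xk' m : exists k,
    [/\ (m < k)%N, (m < n k)%N & approximates X (n k) (L k)] := Xk m.+1.
  pose next m := projT1 (cid (Xk' m)).
  have nextP m : [/\ (m < next m)%N, (m < n (next m))%N &
    approximates X (n (next m)) (L (next m))] by rewrite /next; case: cid.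
  pose K j := iter j.+1 next 0%N.
  have Kj j : (j < K j)%N.
    elim: j => [|j IH]; first by have [] := nextP 0%N.
    by apply: leq_ltn_trans IH _; have [] := nextP (K j).
  exists K; split => // j; last 1 first.
  - by have [/ltnW] := nextP (K j).
  - case: j => // j; have [_ + _] := nextP (K j).
    exact: leq_ltn_trans (ltnW (Kj j)).
  - by have [] := nextP (iter j next 0%N).
have r_mono i j : (i <= j)%N -> r j <= r i.
  by apply: (@homo_leq _ r (fun x y => y <= x)) => // x y z; move/[swap]; exact: le_trans.
have X_0 : X 0 := cuX.2.1.
split; first exact: cuX.1; split => //.
exists (r \o K); split; first by move=> j /=; exact: r0.
split.
  by apply/nonincreasing_seqP => j /=; exact: r_mono.
split.
  apply: (@squeeze_cvgr _ _ _ _ (cst 0) r); [|exact: cvg_cst|exact: r_cvg].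
  by near=> j; rewrite /= (ltW (r0 _)) /= r_mono // ltnW.
move=> c c0.
(* Errors add up to at most [a / 4 + 4 * a], below [5 * a], with [a] at most [j.+1%:R^-1]; the
   factor [N] passes to the Euclidean distance. *)
pose u (j : nat) : R := N%:R * 5 * j.+1%:R^-1.
have u0 : u @ \oo --> 0.
  rewrite -(mulr0 (N%:R * 5)); apply: cvgMl_tmp.
  exact: cvg_harmonic.
have u_ge0 j : 0 <= u j by rewrite /u !mulr_ge0.
have small j (x y : V) : `|x - y| <= 5 * (n (K j)).+1%:R^-1 -> edist x y <= u j.
  move=> xy; apply: (le_trans (edist_le _ _)); rewrite /u -mulrA ler_wpM2l //.
  apply: (le_trans xy); rewrite ler_wpM2l // lef_pV2 ?posrE //.
  by rewrite ler_nat ltnS.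
have in_blowup j y : (exists2 t, t \in `[0, 1] & f t = r (K j) *: y) ->
    blowup X0 0 (r (K j)) y.
  move=> [t t01 ft]; exists (f t); first by exists t.
  by rewrite subr0 ft scalerA mulVf ?scale1r // gt_eqF.
have near_c : \forall j \near \oo, c + 1 <= j%:R.
  by apply: nbhs_infty_ger.
split; apply: (exc_cvg0 u0); near=> j; pose M : R := (n (K j)).+1%:R; pose a := M^-1.
all: have cj : c + 1 <= M.
1,3: apply: (@le_trans _ _ j%:R); [by near: j|by rewrite ler_nat leqW].
all: have apx1 : forall z : V, z \in core R (n (K j)) (L (K j)) -> `|z| <= M ->
  exists2 x, X x & `|z - x| <= 4 * a by exact: (Kapprox j).1.
all: have apx2 : forall x : V, X x -> `|x| <= M -> `|x| <= a \/
  exists2 z : V, z \in core R (n (K j)) (L (K j)) & `|z - x| <= 2 * a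
  by exact: (Kapprox j).2.
all: have small_j : forall x y : V, `|x - y| <= 5 * a -> edist x y <= u j
  by exact: small.
all: have a0 : 0 < a by rewrite invr_gt0 /M.
all: have a1 : a <= 1 by rewrite invf_le1 ?ler1n /M.
all: have rj := r0 (K j).
all: apply: exc_le => // y [].
- move=> [_ [t /= t01 <-] <-]; rewrite subr0.
  set y' : V := _ *: f t; move=> /= yc.
  have {}yc : `|y'| <= c by have := le_trans (normr_le_edist _ _) yc; rewrite sub0r normrN.
  have ftE : f t = r (K j) *: y' by rewrite scalerA mulfV ?scale1r // gt_eqF.
  have nft : `|f t| = r (K j) * `|y'| by rewrite ftE normrZ gtr0_norm.
  (* Zero and tiny points are matched with the origin of [X], points close to the core through
     [apx1]; distant ones would have norm at least [4 * M] after blow-up, beyond [c]. *)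
  have [ft0|[z zq]|ft_le|ft_ge] := (ftr (K j)).2 t t01.
  + by exists 0 => //; apply: small_j; rewrite subr0 /y' ft0 scaler0 normr0 mulr_ge0 // ltW.
  + rewrite ftE -scalerBr normrZ gtr0_norm // ler_pM2l // => y'z.
    have yz : `|y' - z| <= a / 4 by [].
    have [|x Xx zx] := apx1 z zq.
      have : `|z| <= `|y' - z| + `|y'|.
        by rewrite distrC -[X in X <= _](congr1 _ (subrK y' z)) ler_normD.
      lra.
    exists x => //; apply: small_j.
    have : `|y' - x| <= `|y' - z| + `|z - x| by exact: ler_distD.
    lra.
  + exists 0 => //; apply: small_j; rewrite subr0.
    by move: ft_le; rewrite nft mulrCA ler_pM2l // -/M -/a; lra.
  + by move: ft_ge; rewrite nft mulrCA ler_pM2l // -/M; lra.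
- move=> Xy /= yc.
  have {}yc : `|y| <= c by have := le_trans (normr_le_edist _ _) yc; rewrite sub0r normrN.
  have [|ya|[z zq zy]] := apx2 y Xy; first lra.
    exists 0; last by apply: small_j; rewrite subr0; lra.
    by apply: in_blowup; exists 0; [rewrite in_itv /= lexx ler01|rewrite scaler0].
  exists z; last by apply: small_j; rewrite distrC; lra.
  exact/in_blowup/(ftr (K j)).1.
Unshelve. all: end_near. Qed.

End Universality.

Unset Implicit Arguments.

Theorem theoremA1 (R : realType) (N : nat) (hN : (2 <= N)%N) :
  exists f : R -> 'rV[R]_N,
    lipschitz01 f /\ f 0 = 0 /\
    Tan (f @` [set t : R | t \in `[0, 1]]) 0 = @CU R N.
Proof.
have N0 := ltnW hN.
have [n [L [vL univ]]] := @universal_codes R N hN.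
have [l [f [fl f0 ftr]]] := universal_curve N0 vL.
exists f; split; [|split => //].
  exists (N%:R * l) => s t _ _; apply: (le_trans (edist_le _ _)).
  by rewrite -mulrA ler_wpM2l.
have r0 := scale_gt0 R n L.
apply/seteqP; split.
  apply: Tan_sub_CU.
  - apply: connected_continuous_connected.
      rewrite (_ : mkset _ = `[0, 1]%classic); first exact: segment_connected.
      by apply/seteqP; split.
    exact/continuous_subspaceT/(lipschitz_continuous fl).
  - by exists 0; rewrite // /= in_itv /= lexx ler01.
  (* The head of the first pattern is a nonzero point of the curve. *)
  - have [|t t01 ft] := (ftr 0%N).1 (diag N (4 * (n 0%N).+1%:R)); first exact: mem_head.
    exists (f t); first by exists t.
    rewrite ft -normr_gt0 normrZ normr_diag // mulr_gt0 ?mulr_gt0 //.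
    by rewrite normr_gt0 gt_eqF.
move=> X cuX; apply: (CU_sub_Tan f0 r0 _ _ ftr cuX (univ X cuX)).
  exact: scale_decr.
apply: (@squeeze_cvgr _ _ _ _ (cst 0) (fun k => 2^-1 ^+ k)).
- by near=> k; rewrite /= ltW //= scale_le.
- exact: cvg_cst.
- by apply: cvg_expr; rewrite ger0_norm; lra.
Unshelve. all: end_near. Qed.
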